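(* If there exists a propagating terrace $\mathcal{T}=((p_i)_{0\le i\le N},(U_i,c_i)_{1\le i\le N})$ of $u_t=u_{xx}+f(t,u)$ connecting $0$ to $p$ that is minimal, then it is the unique minimal propagating terrace connecting $0$ to $p$, up to spatial shifts.
   Context: Setting: $T>0$; $f:\mathbb{R}\times[0,\infty)\to\mathbb{R}$ is locally Hölder continuous, of class $C^1$ with respect to $u$, $f(t,0)=0$ for all $t$, and $f(t+T,u)=f(t,u)$ for all $t\in\mathbb{R}$, $u\ge 0$. $\mathcal{X}_{per}$ is the set of nonnegative $T$-periodic solutions $q$ of $dq/dt=f(t,q)$; it is assumed to contain a positive element $p$, which is fixed. Inequalities between elements of $\mathcal{X}_{per}$ are pointwise in $t$. An entire solution is a solution of $u_t=u_{xx}+f(t,u)$ defined for all $(t,x)\in\mathbb{R}^2$. Periodic traveling wave: for $q_-<q_+$ in $\mathcal{X}_{per}$, a periodic traveling wave connecting $q_-$ to $q_+$ with wave speed $c\in\mathbb{R}$ is an entire solution $U(t,x)$ with $U(t+T,x+cT)\equiv U(t,x)$ and $U(t,x)\to q_+(t)$ as $x\to-\infty$, $U(t,x)\to q_-(t)$ as $x\to\infty$, locally uniformly in $t\in\mathbb{R}$. Propagating terrace connecting $0$ to $p$: a pair of finite sequences $(p_i)_{0\le i\le N}$, $(U_i,c_i)_{1\le i\le N}$ with $p_i\in\mathcal{X}_{per}$, $p=p_0>p_1>\cdots>p_N=0$, each $U_i$ a periodic traveling wave connecting $p_i$ to $p_{i-1}$ with speed $c_i\in\mathbb{R}$, and $c_1\le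 c_2\le\cdots\le c_N$. Steepness: for piecewise continuous $v_1,v_2:\mathbb{R}\to\mathbb{R}$, $v_1$ is steeper than $v_2$ if whenever $v_1(x_1)=v_2(x_2)$ one has $v_1(x+x_1)\le v_2(x+x_2)$ for $x>0$ and $v_1(x+x_1)\ge v_2(x+x_2)$ for $x<0$. For entire solutions, $u_1$ is steeper than $u_2$ if $u_1(t,\cdot)$ is steeper than $u_2(t,\cdot)$ for each $t\in\mathbb{R}$. A propagating terrace $((p_i)_{0\le i\le N},(U_i,c_i)_{1\le i\le N})$ is minimal if (1) for any propagating terrace $((p_i')_{0\le i\le N'},(U_i',c_i')_{1\le i\le N'})$ connecting $0$ to $p$, $\{p_i\}_{0\le i\le N}\subset\{p_i'\}_{0\le i\le N'}$; and (2) for each $1\le i\le N$, $U_i$ is steeper than any other periodic traveling wave connecting $p_i$ to $p_{i-1}$. Two propagating terraces $((p_i)_i,(U_i,c_i)_i)$ and $((p_i')_i,(U_i',c_i')_i)$ are equal up to spatial shifts if $p_i\equiv p_i'$ and $c_i=c_i'$ for every $i$, and $U_i(t,x+a_i)=U_i'(t,x)$ for some constants $a_i$, $i=1,\dots,N$. *)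

(* Defs.v *)
From HB Require Import structures.
From mathcomp Require Import all_boot all_order all_algebra.
From mathcomp Require Import all_classical all_reals all_analysis.

Set Implicit Arguments.
Unset Strict Implicit.
Unset Printing Implicit Defensive.

Import Order.TTheory GRing.Theory Num.Theory.
Import numFieldNormedType.Exports.

Local Open Scope classical_set_scope.
Local Open Scope ring_scope.

(* A nonlinearity f : R x [0, +oo[ -> R is encoded as a total function
   R -> R -> R; no definition below uses its values at u < 0. *)

Definition locally_hoelder (R : realType) (f : R -> R -> R) : Prop :=
  forall z0 : R * R, 0 <= z0.2 ->
  exists alpha C : R, [/\ 0 < alpha, alpha <= 1 &
    \forall z & w \near z0, 0 <= z.2 -> 0 <= w.2 ->
      `|f z.1 z.2 - f w.1 w.2| <= C * `|z - w| `^ alpha].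

(* f(t, .) is C^1 on [0, +oo[ for each t; the derivative at u = 0 is
   one-sided. *)
Definition C1_in_u (R : realType) (f : R -> R -> R) : Prop :=
  forall t : R, exists df : R -> R,
    (forall u : R, 0 <= u ->
       (f t v - f t u) / (v - u) @[v --> within [set v | 0 <= v] u^'] --> df u)
    /\ {within [set u | 0 <= u], continuous df}.

Definition standing_assumptions (R : realType) (T : R) (f : R -> R -> R)
    : Prop :=
  [/\ 0 < T, locally_hoelder f, C1_in_u f, (forall t, f t 0 = 0) &
      forall t u, 0 <= u -> f (t + T) u = f t u].

Definition Xper (R : realType) (T : R) (f : R -> R -> R) : set (R -> R) :=
  [set q : R -> R | [/\ forall t, 0 <= q t, periodic q T &
               forall t : R, is_derive t 1 q (f t (q t))]].

Definition dt (R : realType) (u : R -> R -> R) (t x : R) : R := derive1 (u ^~ x) t.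
Definition dx (R : realType) (u : R -> R -> R) (t x : R) : R := derive1 (u t) x.

Definition jointly_continuous (R : realType) (u : R -> R -> R) : Prop :=
  continuous (fun z : R * R => u z.1 z.2).

(* Continuously differentiable once in t and twice in x. *)
Definition C12 (R : realType) (u : R -> R -> R) : Prop :=
  [/\ forall t x : R, derivable (u ^~ x) t 1,
      forall t x : R, derivable (u t) x 1,
      forall t x : R, derivable (dx u t) x 1 &
      [/\ jointly_continuous u, jointly_continuous (dt u),
          jointly_continuous (dx u) & jointly_continuous (dx (dx u))]].

(* Nonnegativity is part of the definition because f(t, u) is only meaningful
   for u >= 0. *)
Definition entire_solution (R : realType) (f : R -> R -> R) (u : R -> R -> R)
    : Prop :=
  [/\ C12 u, (forall t x, 0 <= u t x) &
      forall t x, dt u t x = dx (dx u) t x + f t (u t x)].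

Definition steeper (R : realType) (v1 v2 : R -> R) : Prop :=
  forall x1 x2, v1 x1 = v2 x2 ->
    (forall x, 0 < x -> v1 (x + x1) <= v2 (x + x2)) /\
    (forall x, x < 0 -> v2 (x + x2) <= v1 (x + x1)).

Definition steeper_entire (R : realType) (u1 u2 : R -> R -> R) : Prop :=
  forall t, steeper (u1 t) (u2 t).

Definition periodic_wave (R : realType) (T : R) (f : R -> R -> R)
    (qm qp : R -> R) (U : R -> R -> R) (c : R) : Prop :=
  [/\ Xper T f qm /\ Xper T f qp, (forall t, qm t < qp t), entire_solution f U,
      (forall t x, U (t + T) (x + c * T) = U t x) &
      {family compact, (fun x : R => (U ^~ x : R -> R)) @ -oo --> qp} /\
      {family compact, (fun x : R => (U ^~ x : R -> R)) @ +oo --> qm}].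

(* The finite sequences (p_i)_{0 <= i <= N} and (U_i, c_i)_{1 <= i <= N} are
   stored as functions on nat; no definition below uses their values at indices
   outside these ranges. *)
Record terrace (R : realType) := Terrace {
  tN : nat;
  tp : nat -> R -> R;
  tU : nat -> R -> R -> R;
  tc : nat -> R }.

Definition propagating_terrace (R : realType) (T : R) (f : R -> R -> R)
    (p : R -> R) (A : terrace R) : Prop :=
  [/\ forall i, (i <= tN A)%N -> Xper T f (tp A i),
      tp A 0%N = p /\ tp A (tN A) = (fun=> 0),
      forall i, (i < tN A)%N -> forall t, tp A i.+1 t < tp A i t,
      forall i, (1 <= i <= tN A)%N ->
        periodic_wave T f (tp A i) (tp A i.-1) (tU A i) (tc A i) &
      forall i, (1 <= i < tN A)%N -> tc A i <= tc A i.+1].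

Definition platforms (R : realType) (A : terrace R) : set (R -> R) :=
  tp A @` [set i | (i <= tN A)%N].

Definition minimal_terrace (R : realType) (T : R) (f : R -> R -> R)
    (p : R -> R) (A : terrace R) : Prop :=
  [/\ propagating_terrace T f p A,
      forall B, propagating_terrace T f p B -> platforms A `<=` platforms B &
      forall i, (1 <= i <= tN A)%N ->
        forall (V : R -> R -> R) (c : R),
          periodic_wave T f (tp A i) (tp A i.-1) V c ->
          V <> tU A i -> steeper_entire (tU A i) V].

Definition equal_up_to_shifts (R : realType) (A B : terrace R) : Prop :=
  [/\ tN A = tN B,
      forall i, (i <= tN A)%N -> tp A i = tp B i &
      forall i, (1 <= i <= tN A)%N ->
        tc A i = tc B i /\ exists a, forall t x, tU A i t (x + a) = tU B i t x].

(* Main.v *)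
Require Import Defs.
From mathcomp Require Import all_boot all_order all_algebra.
From mathcomp Require Import all_classical all_reals all_analysis.
From mathcomp Require Import ring lra.

Set Implicit Arguments.
Unset Strict Implicit.
Unset Printing Implicit Defensive.

Import Order.TTheory GRing.Theory Num.Theory.
Import numFieldNormedType.Exports.
Local Open Scope classical_set_scope.
Local Open Scope ring_scope.

(** The platforms of a minimal terrace are platforms of every terrace, so two
    minimal terraces have the same set of platforms; as the platforms of a
    terrace are strictly decreasing, this set determines their number and their
    order ([eq_range_eq_seq]). It remains to compare two waves [U] and [V] that
    connect the same platforms and, by minimality, are steeper than each other.

    At a fixed time, [U t] and [V t] have the same limits at infinity, so both
    take the intermediate value halfway between these limits. Being steeper in
    both directions turns one common value into equality of the two profiles up
    to a translation: [V t x = U t (x + a t)]. The same argument, applied at two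
    points where [U t] takes the same value, makes [U t] invariant under a
    translation, which is impossible for a function with two different limits;
    hence [U t] is injective and therefore decreasing ([steeper_antisym],
    [injective_front_decreasing]).

    The shift [a] is constant in time. Formally, differentiating the relation
    between [U] and [V] in [t] gives
      [V_t (t, x) = U_t (t, x + a t) + a' t * U_x (t, x + a t)],
    while [V_xx] and the reaction term at [(t, x)] agree with those of [U] at
    [(t, x + a t)]. The equation then forces [a' t * U_x = 0], and [U_x (t, _)]
    is not identically zero, so [a' = 0]. The differentiability of [a], taken
    for granted here, is obtained along the way: monotonicity of the profiles
    gives continuity ([shift_continuous]), and then the mean value theorem
    bounds the increments of [a] by those of a function of [t] whose derivative
    vanishes ([shift_derive0]).

    Finally, two waves that differ by a constant shift have the same speed,
    since otherwise their profiles would be periodic in [x] ([shift_speed]). *)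

(** * Finite strictly decreasing sequences *)

Section StrictlyDecreasing.
Variables (X : Type) (lt : X -> X -> Prop).
Hypotheses (lt_irr : forall x, ~ lt x x)
  (lt_tr : forall y x z, lt x y -> lt y z -> lt x z).

Definition decreasing_upto (N : nat) (a : nat -> X) : Prop :=
  forall i, (i < N)%N -> lt (a i.+1) (a i).

Lemma decreasing_upto_lt N a i j : decreasing_upto N a ->
  (i < j)%N -> (j <= N)%N -> lt (a j) (a i).
Proof.
move=> Da; elim: j => // j IH; rewrite ltnS leq_eqVlt => /predU1P[->|ij] jN.
  exact: Da.
exact: lt_tr (Da _ jN) (IH ij (ltnW jN)).
Qed.

(** A step down in [a] is a descent in [b] as well, so it raises the index in
    [b] by at least one. *)
Lemma sub_range_le_index N M a b :
  decreasing_upto N a -> decreasing_upto M b ->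
  a @` [set i | (i <= N)%N] `<=` b @` [set j | (j <= M)%N] ->
  forall i, (i <= N)%N -> exists j, [/\ (i <= j)%N, (j <= M)%N & b j = a i].
Proof.
move=> Da Db sab; elim=> [_|i IH iN].
  have [|j jM bj] := sab (a 0%N); first by exists 0%N.
  by exists j.
have [j [ij jM bj]] := IH (ltnW iN).
have [|k kM bk] := sab (a i.+1); first by exists i.+1.
exists k; split=> //; apply: leq_ltn_trans ij _; rewrite ltnNge; apply/negP.
have lt_kj : lt (b k) (b j) by rewrite bk bj; exact: Da.
rewrite leq_eqVlt => /predU1P[ekj|kj].
  by rewrite ekj in lt_kj; exact: lt_irr lt_kj.
exact: lt_irr (lt_tr lt_kj (decreasing_upto_lt Db kj jM)).
Qed.

(** Applying [sub_range_le_index] in both directions sends an index of [a] to an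
    index of [b] and back without ever decreasing it; as the terms of [a] are
    distinct, the round trip is the identity and no index moves. *)
Lemma eq_range_eq_seq N M a b :
  decreasing_upto N a -> decreasing_upto M b ->
  a @` [set i | (i <= N)%N] = b @` [set j | (j <= M)%N] ->
  N = M /\ forall i, (i <= N)%N -> a i = b i.
Proof.
move=> Da Db eab.
have iab : forall i, (i <= N)%N -> exists j, [/\ (i <= j)%N, (j <= M)%N & b j = a i].
  by apply: sub_range_le_index; rewrite ?eab.
have iba : forall i, (i <= M)%N -> exists j, [/\ (i <= j)%N, (j <= N)%N & a j = b i].
  by apply: sub_range_le_index; rewrite ?eab.
split.
  apply/eqP; rewrite eqn_leq; apply/andP; split.
    by have [j [/leq_trans h /h]] := iab _ (leqnn N).
  by have [j [/leq_trans h /h]] := iba _ (leqnn M).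
move=> i iN; have [j [ij jM bj]] := iab i iN; have [k [jk kN ak]] := iba j jM.
have ik : i = k.
  apply/eqP; rewrite eqn_leq (leq_trans ij jk) /= leqNgt; apply/negP=> ltik.
  by have := decreasing_upto_lt Da ltik kN; rewrite ak bj; exact: lt_irr.
rewrite -bj; congr b; apply/esym.
by apply/eqP; rewrite eqn_leq ij /= ik jk.
Qed.

End StrictlyDecreasing.

(** * Profiles with two different limits at infinity *)

Definition front (R : realType) (l r : R) (v : R -> R) : Prop :=
  [/\ r < l, continuous v, v x @[x --> -oo] --> l & v x @[x --> +oo] --> r].

Section Fronts.
Variables (R : realType) (l r : R).

(** The midpoint of the limits separates the profile near -oo from the profile
    near +oo; this is all that the next lemmas use of the limits. *)
Lemma front_split v : front l r v ->
  exists M, (forall x, x < - M -> (l + r) / 2 < v x) /\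
            (forall x, M < x -> v x < (l + r) / 2).
Proof.
move=> [rl _ vl vr].
have lr0 : 0 < (l - r) / 2 by lra.
have /cvgrPdist_lt/(_ _ lr0) [M1 [_ HM1]] := vl.
have /cvgrPdist_lt/(_ _ lr0) [M2 [_ HM2]] := vr.
exists (`|M1| + `|M2|); split=> x xM.
  have /HM1 : x < M1.
    by have := ler_norm (- M1); have := normr_ge0 M2; rewrite normrN; lra.
  by rewrite /= ltr_distlC => /andP[]; lra.
have /HM2 : M2 < x by have := ler_norm M2; have := normr_ge0 M1; lra.
by rewrite /= ltr_distlC => /andP[]; lra.
Qed.

(** Translating far enough by multiples of the period to either side places any
    value on both sides of the midpoint of the limits. *)
Lemma front_aperiodic v h : front l r v -> (forall x, v (x + h) = v x) -> h = 0.
Proof.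
move=> fv; wlog h0 : h / 0 < h => [wl|] vh.
  have [h0|h0|//] := ltgtP h 0; last exact: wl.
  have /wl : 0 < - h by lra.
  have vNh x : v (x - h) = v x by rewrite -{2}(subrK h x) vh.
  by move=> /(_ vNh); lra.
have vhn n x : v (x + h *+ n) = v x.
  by elim: n => [|n IH]; rewrite ?mulr0n ?addr0 // mulrSr addrA vh.
have [M [above below]] := front_split fv.
have [n nh] : exists n, M + M + 2 < h *+ n.
  exists (Num.bound `|(M + M + 2) / h|).
  rewrite -[h *+ _]mulr_natl -ltr_pdivrMr //.
  exact: le_lt_trans (ler_norm _) (archi_boundP (normr_ge0 _)).
have := above (- M - 1); have := below (- M - 1 + h *+ n); rewrite vhn.
move: (h *+ n) nh => z nh h2 h1.
by have := h1 ltac:(lra); have := h2 ltac:(lra); lra.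
Qed.

Lemma front_midpoint v : front l r v -> exists x, v x = (l + r) / 2.
Proof.
move=> fv.
have [M [above below]] := front_split fv.
have ltMb : M < `|M| + 1 by have := ler_norm M; lra.
have ltbM : - (`|M| + 1) < - M by rewrite ltrN2.
have b0 : - (`|M| + 1) <= `|M| + 1 by have := normr_ge0 M; lra.
have [| |x _ xv] := @IVT R v (- (`|M| + 1)) (`|M| + 1) ((l + r) / 2) b0; last by exists x.
  by apply: continuous_subspaceT => x; have [_ cv _ _] := fv; exact: cv.
by rewrite ge_min le_max (ltW (below _ ltMb)) (ltW (above _ ltbM)) orbT.
Qed.

(** An injective continuous function is monotone, and the limits select the
    direction. *)
Lemma injective_front_decreasing v : front l r v -> injective v ->
  {mono v : x y /~ x <= y}.
Proof.
move=> fv injv x y.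
have cv : {within [set` `]-oo, +oo[], continuous v}.
  by apply: continuous_subspaceT => z; have [_ cv _ _] := fv; exact: cv.
apply: (itv_continuous_inj_ge _ cv) => //; last by move=> ? ? _ _; apply: injv.
have [M [above below]] := front_split fv.
exists (- `|M| - 1), (`|M| + 1); split=> //.
  by have := normr_ge0 M; lra.
apply/ltW; apply: (lt_trans (below _ _)) (above _ _).
  by have := ler_norm M; lra.
by have := ler_norm M; lra.
Qed.

(** Each crossing of [v] and [w] aligns the two profiles completely. The
    midpoint of the limits provides one crossing, hence the shift [a]; and
    [v x1 = v x2] provides two crossings with one and the same point of [w], so
    that [v] would be periodic unless [x1 = x2]. *)
Lemma steeper_antisym v w : front l r v -> front l r w ->
  steeper v w -> steeper w v ->
  (exists a, forall x, w x = v (x + a)) /\ injective v.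
Proof.
move=> fv fw vw wv.
have eqvw x1 x2 : v x1 = w x2 -> forall x, v (x + x1) = w (x + x2).
  move=> e x; have [p1 n1] := vw _ _ e; have [p2 n2] := wv _ _ (esym e).
  have [x0|x0|->] := ltgtP x 0; last by rewrite !add0r.
    by apply/eqP; rewrite eq_le n2 ?n1.
  by apply/eqP; rewrite eq_le p1 ?p2.
have [a wa] : exists a, forall x, w x = v (x + a).
  have [x1 e1] := front_midpoint fv; have [x2 e2] := front_midpoint fw.
  exists (x1 - x2) => x; rewrite -{1}(subrK x2 x) -(eqvw x1 x2) ?e1 ?e2 //.
  by congr v; ring.
split; first by exists a.
move=> x1 x2 e; apply/eqP; rewrite -subr_eq0; apply/eqP.
apply: (front_aperiodic fv) => x.
have e' : v x1 = w (x2 - a) by rewrite wa subrK.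
have := eqvw _ _ e' (x - x2); rewrite wa.
have -> : x - x2 + x1 = x + (x1 - x2) by ring.
by move=> ->; congr v; ring.
Qed.
End Fronts.

(** * Tools from one-variable calculus *)

Lemma derive1_shift (R : realType) (g : R -> R) (a x : R) :
  derive1 (fun y => g (y + a)) x = derive1 g (x + a).
Proof.
rewrite /derive1; set F := fun h : R => _; set G := fun h : R => _.
by have -> : F = G by apply/funext => h; rewrite /F /G /= addrA.
Qed.

(** A mean value theorem that does not ask which of [x] and [y] is larger: the
    position of the intermediate point is given by its distance to [x]. *)
Lemma MVT_dist (R : realType) (g : R -> R) (x y : R) :
  (forall z, derivable g z 1) ->
  exists2 c, `|c - x| <= `|y - x| & g y - g x = derive1 g c * (y - x).
Proof.
move=> dg.
have dg' (z : R) : is_derive z 1 g (derive1 g z) by rewrite derive1E; apply: derivableP.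
have cg : continuous g by move=> z; apply/differentiable_continuous/derivable1_diffP.
have MVT u v : u <= v ->
    exists2 c, u <= c <= v & g v - g u = derive1 g c * (v - u).
  move=> uv; have [|c cuv e] := MVT_segment uv (fun z _ => dg' z).
    exact: continuous_subspaceT.
  by exists c => //; rewrite in_itv in cuv.
have [xy|/ltW yx] := leP x y.
  have [c /andP[xc cy] e] := MVT _ _ xy; exists c => //.
  by rewrite !ger0_norm ?subr_ge0 //; lra.
have [c /andP[yc cx] e] := MVT _ _ yx; exists c; last by rewrite -opprB e; ring.
by rewrite !ler0_norm ?subr_le0 //; lra.
Qed.

(** This yields differentiability of [a], not only the value of its derivative:
    the difference quotients of [a] are squeezed by those of [D]. *)
Lemma is_derive0_dominated (R : realType) (a D : R -> R) (t0 C : R) :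
  0 < C -> is_derive t0 1 D 0 ->
  (\forall t \near t0, `|a t - a t0| <= C * `|D t - D t0|) ->
  is_derive t0 1 a 0.
Proof.
move=> C0 dD le_aD.
have shift_t0 : h *: 1 + t0 @[h --> (0 : R)^'] --> t0.
  have : h *: 1 + t0 @[h --> (0 : R)] --> (0 : R) *: (1 : R) + t0.
    by apply: cvgD; [exact: scalel_continuous|exact: cvg_cst].
  rewrite scale0r add0r; exact: cvg_within_filter.
have dqD : h^-1 *: ((D \o shift t0) (h *: 1) - D t0) @[h --> 0^'] --> (0 : R).
  by have := @ex_derive _ _ _ _ _ _ _ dD; rewrite /derivable -/(derive D t0 1) derive_val.
have dqa : h^-1 *: ((a \o shift t0) (h *: 1) - a t0) @[h --> 0^'] --> (0 : R).
  apply/cvgrPdist_lt => e e0.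
  have ke0 : 0 < e / C by rewrite divr_gt0.
  have /cvgrPdist_lt/(_ _ ke0) qD := dqD.
  have le_shift := shift_t0 _ le_aD.
  near=> h; rewrite sub0r normrN /= normrZ.
  have : `|h^-1 *: (D (h *: 1 + t0) - D t0)| < e / C.
    by rewrite -normrN -sub0r; near: h.
  have : `|a (h *: 1 + t0) - a t0| <= C * `|D (h *: 1 + t0) - D t0|.
    by near: h; exact: le_shift.
  rewrite normrZ ltr_pdivlMr // => le lt; apply: le_lt_trans lt.
  by rewrite -mulrA ler_wpM2l // mulrC.
apply: DeriveDef; first by apply/cvg_ex; exists 0.
exact: cvg_lim.
Unshelve. all: by end_near. Qed.

(** * Waves that are translates of each other at each time *)

Lemma wave_front (R : realType) (T : R) (f : R -> R -> R) qm qp U c t :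
  periodic_wave T f qm qp U c -> front (qp t) (qm t) (U t).
Proof.
move=> [_ qmp [[_ dxU _ _] _ _] _ [Ul Ur]]; split; first exact: qmp.
- by move=> x; apply/differentiable_continuous/derivable1_diffP.
- by have /pointwise_cvg_compact_family/pointwise_cvgP := Ul; apply.
- by have /pointwise_cvg_compact_family/pointwise_cvgP := Ur; apply.
Qed.

Section Shift.
Variables (R : realType) (f : R -> R -> R) (U V : R -> R -> R) (a : R -> R).
Hypotheses (eU : entire_solution f U) (eV : entire_solution f V).
Hypothesis VU : forall t x, V t x = U t (x + a t).

(** Monotonicity brackets the shift: [a t] lies within [e] of [a t0] as soon as
    [V t 0] lies between the values of [U t] at [a t0 + e] and [a t0 - e]. These
    two inequalities are strict at [t0] and involve only the continuity in [t]
    of [U] and [V] at fixed positions. *)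
Lemma shift_continuous :
  (forall t, {mono U t : x y /~ x <= y}) -> continuous a.
Proof.
move=> monoU t0.
have ct W : entire_solution f W -> forall x, {for t0, continuous (W ^~ x)}.
  by move=> [[dW _ _ _] _ _] x; apply/differentiable_continuous/derivable1_diffP.
have lt_mono t : {mono U t : x y /~ x < y} by apply: leW_nmono.
apply/cvgrPdist_lt => e e0.
have V0 : V t0 0 = U t0 (a t0) by rewrite VU add0r.
have below : \forall t \near t0, U t (a t0 + e) < V t 0.
  have c : {for t0, continuous (fun t => V t 0 - U t (a t0 + e))}.
    by apply: continuousB; apply: ct.
  have : \forall t \near t0, 0 < V t 0 - U t (a t0 + e).
    by apply: (cvgr_gt _ c); rewrite V0 subr_gt0 lt_mono; lra.
  by apply: filterS => t; rewrite subr_gt0.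
have above : \forall t \near t0, V t 0 < U t (a t0 - e).
  have c : {for t0, continuous (fun t => U t (a t0 - e) - V t 0)}.
    by apply: continuousB; apply: ct.
  have : \forall t \near t0, 0 < U t (a t0 - e) - V t 0.
    by apply: (cvgr_gt _ c); rewrite V0 subr_gt0 lt_mono; lra.
  by apply: filterS => t; rewrite subr_gt0.
near=> t.
have b1 : U t (a t0 + e) < V t 0 by near: t.
have b2 : V t 0 < U t (a t0 - e) by near: t.
move: b1 b2; rewrite VU add0r !lt_mono ltr_distlC => -> ?.
by rewrite andbT; lra.
Unshelve. all: by end_near. Qed.

(** The function [D t = V t x0 - U t y0], where [x0] is the point that the shift
    at time [t0] sends to [y0], vanishes at [t0] together with its derivative,
    because both solutions satisfy the same equation and their profiles at [t0]
    agree up to translation. On the other hand [D t] is the increment of [U t]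
    between [y0] and [y0 + (a t - a t0)], which is comparable to [a t - a t0]
    since [U_x] stays away from zero near [(t0, y0)]. *)
Lemma shift_derive0 t0 y0 : continuous a -> dx U t0 y0 != 0 ->
  is_derive t0 1 a 0.
Proof.
move=> ca U0.
have [[dtU dxU _ [_ _ cdxU _]] _ pdeU] := eU.
have [[dtV dxV _ _] _ pdeV] := eV.
pose x0 := y0 - a t0.
have x0a : x0 + a t0 = y0 by rewrite /x0 subrK.
have Vt0 : V t0 = fun x => U t0 (x + a t0) by apply/funext => x.
have dxxV : dx (dx V) t0 x0 = dx (dx U) t0 y0.
  have e : dx V t0 = fun x => dx U t0 (x + a t0).
    by apply/funext => x; rewrite /dx Vt0 derive1_shift.
  by rewrite {1}/dx e derive1_shift x0a.
pose D t := V t x0 - U t y0.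
have dD : is_derive t0 1 D 0.
  have dV' : is_derive t0 1 (V ^~ x0) (dt V t0 x0).
    by rewrite /dt derive1E; apply: derivableP.
  have dU' : is_derive t0 1 (U ^~ y0) (dt U t0 y0).
    by rewrite /dt derive1E; apply: derivableP.
  have -> : 0 = dt V t0 x0 - dt U t0 y0.
    by rewrite pdeV pdeU dxxV VU x0a subrr.
  exact: is_deriveB.
have D0 : D t0 = 0 by rewrite /D VU x0a subrr.
pose k := `|dx U t0 y0| / 2.
have k0 : 0 < k by rewrite divr_gt0 ?normr_gt0.
have le_aD : \forall t \near t0, `|a t - a t0| <= k^-1 * `|D t|.
  (* As |U_x| is 2k at (t0, y0) and U_x varies by less than k within distance e,
     |U_x| is at least k there. *)
  have /cvgrPdist_lt/(_ k k0) := cdxU (t0, y0).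
  move=> /nbhs_ballP[e /= e0 He].
  have /cvgrPdist_lt/(_ e e0) := ca t0.
  move=> a_near; near=> t.
  have [y yd DE] := MVT_dist y0 (x0 + a t) (dxU t).
  have ad : `|a t - a t0| < e by rewrite distrC; near: t.
  have yae : x0 + a t - y0 = a t - a t0 by rewrite /x0; ring.
  rewrite yae in yd DE.
  have kd : k <= `|derive1 (U t) y|.
    have /= := He (t, y); rewrite -/(dx U t y) => /(_ _).
    have tb : ball (t0, y0) e (t, y).
      split; last by rewrite /ball /= distrC; exact: le_lt_trans yd ad.
      by near: t; exact: nbhsx_ballx.
    move=> /(_ tb); rewrite /k.
    have := lerB_dist (dx U t0 y0) (dx U t y); lra.
  rewrite ler_pdivlMl // /D VU DE normrM.
  by apply: ler_wpM2r.
apply: (is_derive0_dominated (C := k^-1) _ dD); rewrite ?invr_gt0 //.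
by apply: filterS le_aD => t; rewrite D0 subr0.
Unshelve. all: by end_near. Qed.
End Shift.

Lemma constant_shift (R : realType) (T : R) (f : R -> R -> R) qm qp U V c c' :
  periodic_wave T f qm qp U c -> periodic_wave T f qm qp V c' ->
  steeper_entire U V -> steeper_entire V U ->
  exists a, forall t x, U t (x + a) = V t x.
Proof.
move=> wU wV sUV sVU.
have fU t := wave_front t wU; have fV t := wave_front t wV.
have [_ _ eU _ _] := wU; have [_ _ eV _ _] := wV.
have /choice[a VU] t := (steeper_antisym (fU t) (fV t) (sUV t) (sVU t)).1.
have injU t := (steeper_antisym (fU t) (fV t) (sUV t) (sVU t)).2.
have ca := shift_continuous eU eV VU (fun t => injective_front_decreasing (fU t) (injU t)).
have da (t : R) : is_derive t 1 a 0.
  (* Otherwise [U t] would be constant, contradicting its injectivity. *)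
  have [y0 U0] : exists y0, dx U t y0 != 0.
    apply/not_existsP => H0.
    have dU0 (y : R) : is_derive y 1 (U t) 0.
      have -> : 0 = derive1 (U t) y by apply/esym/eqP/negP => /negP; exact: H0.
      by rewrite derive1E; apply: derivableP; have [[_ dU _ _] _ _] := eU.
    by have /eqP := injU t _ _ (is_derive_0_is_cst 0 1 dU0); rewrite eq_sym oner_eq0.
  exact: shift_derive0 eU eV VU _ _ ca U0.
exists (a 0) => t x.
by rewrite VU (is_derive_0_is_cst 0 t da).
Qed.

(** Advancing by one period of time moves [U] by [c * T] and [V] by [c' * T];
    as [V] is [U] up to a constant shift, the profile of [U] is invariant under
    the translation by the difference. *)
Lemma shift_speed (R : realType) (T : R) (f : R -> R -> R) qm qp U V c c' a :
  T != 0 ->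
  periodic_wave T f qm qp U c -> periodic_wave T f qm qp V c' ->
  (forall t x, U t (x + a) = V t x) -> c = c'.
Proof.
move=> T0 wU wV UV.
have [_ _ _ pU _] := wU; have [_ _ _ pV _] := wV.
have : (c - c') * T = 0.
  apply: (front_aperiodic (wave_front 0 wU)) => x.
  pose y := x - a - c' * T.
  have -> : x = y + c' * T + a by rewrite /y; ring.
  have -> : y + c' * T + a + (c - c') * T = y + a + c * T by ring.
  by rewrite UV -[X in U X](subrK T 0) -[X in V X](subrK T 0) pU pV UV.
by move/eqP; rewrite mulf_eq0 (negbTE T0) orbF subr_eq0 => /eqP.
Qed.

(** * Uniqueness of minimal terraces *)

Theorem proposition1p5 (R : realType) (T : R) (f : R -> R -> R) (p : R -> R)
    (hf : standing_assumptions T f)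
    (hp : Xper T f p) (hp0 : forall t, 0 < p t)
    (A : terrace R) (hA : minimal_terrace T f p A) :
  forall B : terrace R, minimal_terrace T f p B -> equal_up_to_shifts A B.
Proof.
move=> B [tB minB steepB]; have [tA minA steepA] := hA.
have [T0 _ _ _ _] := hf.
have [_ _ decA waveA _] := tA; have [_ _ decB waveB _] := tB.
have [eN ep] : tN A = tN B /\ forall i, (i <= tN A)%N -> tp A i = tp B i.
  apply: (@eq_range_eq_seq _ (fun q q' : R -> R => forall t, q t < q' t)) => //.
  - by move=> q /(_ 0); rewrite ltxx.
  - by move=> q2 q1 q3 q12 q23 t; exact: lt_trans (q12 t) (q23 t).
  by apply/seteqP; split; [exact: minA|exact: minB].
split=> // i iN; have /andP[i0 iNA] := iN.
have epi : tp A i = tp B i by exact: ep.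
have epi1 : tp A i.-1 = tp B i.-1 by apply: ep; exact: leq_trans (leq_pred i) iNA.
have wA := waveA i iN.
have wB : periodic_wave T f (tp A i) (tp A i.-1) (tU B i) (tc B i).
  by rewrite epi epi1; apply: waveB; rewrite -eN.
suff [a UV] : exists a, forall t x, tU A i t (x + a) = tU B i t x.
  by split; [exact: shift_speed (lt0r_neq0 T0) wA wB UV|exists a].
(* Minimality only compares a wave of a terrace with different waves. *)
have [->|neq] := pselect (tU B i = tU A i).
  by exists 0 => t x; rewrite addr0.
apply: (constant_shift wA wB (steepA _ iN _ _ wB neq)).
apply: (steepB i); first by rewrite -eN.
  by rewrite -epi -epi1; exact: wA.
by move=> e; exact: neq (esym e).
Qed.
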